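(* Let $\tau\in\{123,321\}\subset S_3$ and let $l\ge2$ be fixed. Let $C_j=\frac1{j+1}\binom{2j}{j}$, $j\ge0$, denote the $j$th Catalan number. (i) For every fixed integer $k\ge1$, $$\lim_{n\to\infty}P_n^{\mathrm{av}(\tau)}(A^{(n)}_{l;k})=\lim_{n\to\infty}P_n^{\mathrm{av}(\tau)}(A^{(n)}_{l;n+2-k-l})=\frac1{4^{l-1}}+\frac{C_{k-1}(C_l-1)}{4^{k+l-1}}.$$ (ii) If $\{k_n\}$ is a sequence of integers with $1\le k_n\le n-l+1$ and $\lim_{n\to\infty}k_n=\lim_{n\to\infty}(n-k_n)=\infty$, then $$\lim_{n\to\infty}P_n^{\mathrm{av}(\tau)}(A^{(n)}_{l;k_n})=\frac1{4^{l-1}}.$$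
   Context: $S_n$ is the set of permutations of $[n]=\{1,\dots,n\}$, written $\sigma=\sigma_1\sigma_2\cdots\sigma_n$. For $l\in\{2,\dots,n-1\}$ and $k\ge1$ with $k+l-1\le n$, $A^{(n)}_{l;k}\subset S_n$ is the set of $\sigma\in S_n$ for which there exists $a$ with $\{k,k+1,\dots,k+l-1\}=\{\sigma_a,\sigma_{a+1},\dots,\sigma_{a+l-1}\}$. For $\tau\in S_m$ with $2\le m\le n$, $\sigma\in S_n$ contains $\tau$ as a pattern if there are indices $1\le i_1<\cdots<i_m\le n$ such that for all $1\le j,j'\le m$, $\sigma_{i_j}<\sigma_{i_{j'}}$ if and only if $\tau_j<\tau_{j'}$; otherwise $\sigma$ avoids $\tau$. $S_n(\tau)$ is the set of $\sigma\in S_n$ avoiding $\tau$; if $n<m$, $S_n(\tau)=S_n$. $P_n^{\mathrm{av}(\tau)}$ is the uniform probability measure on $S_n(\tau)$, so $P_n^{\mathrm{av}(\tau)}(A)=|A\cap S_n(\tau)|/|S_n(\tau)|$ for $A\subset S_n$. *)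

(* Defs.v *)
From mathcomp Require Import all_boot all_order all_algebra all_fingroup.
From mathcomp Require Import all_classical all_reals all_analysis.

Set Implicit Arguments.
Unset Strict Implicit.
Unset Printing Implicit Defensive.

Import Order.TTheory GRing.Theory Num.Theory.
Import numFieldNormedType.Exports.

Local Open Scope ring_scope.

(* Permutations of [n] are elements of 'S_n, which act on {0, ..., n-1}:
   the letter sigma_(i+1) of the one-line notation is (s i).+1. *)

(* No increasing f exists when n < m, so that every s then avoids tau. *)
Definition contains_pattern (m n : nat) (tau : 'S_m) (s : 'S_n) : bool :=
  [exists f : {ffun 'I_m -> 'I_n},
     [forall j : 'I_m, forall j' : 'I_m, (j < j')%N ==> (f j < f j')%N] &&
     [forall j : 'I_m, forall j' : 'I_m,
        (s (f j) < s (f j'))%N == (tau j < tau j')%N]].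

Definition avoiders (m n : nat) (tau : 'S_m) : {set 'S_n} :=
  [set s : 'S_n | ~~ contains_pattern tau s].

(* The value k is 1-based, hence v.+1; the position a is 0-based.
   Meaningful for 2 <= l < n, 1 <= k and k + l - 1 <= n. *)
Definition Acl (n l k : nat) : {set 'S_n} :=
  [set s : 'S_n | [exists a : 'I_n,
     (a + l <= n)%N &&
     ([set v : 'I_n | (k <= v.+1 < k + l)%N] ==
      [set s i | i : 'I_n & (a <= i < a + l)%N])]].

Definition Pav (R : realType) (m n : nat) (tau : 'S_m) (A : {set 'S_n}) : R :=
  #|A :&: avoiders n tau|%:R / #|avoiders n tau|%:R.

Definition pat123 : 'S_3 := 1%g.
Definition pat321 : 'S_3 := perm (@rev_ord_inj 3).

Definition catalan (R : realType) (j : nat) : R :=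
  1 / j.+1%:R * 'C(2 * j, j)%:R.

(* Main.v *)
(* The inverse of a permutation counted by Acl maps the interval of positions
   [K, K + l), K = k - 1, onto an interval, and avoids 321 as the permutation
   does.  Collapse this block to a point.  If the block is increasing, the
   collapsed permutation is an arbitrary 321-avoider of size n - l + 1.  If the
   block has an inversion, no entry lies above and left, or below and right, of
   it, so the permutation is a direct sum of three 321-avoiders of sizes K, l
   and q = n - l - K.  Hence there are C_(n-l+1) + (C_l - 1) C_K C_q such
   permutations.  The limits follow from C_n / C_(n+j) -> 4^-j and from
   C_K C_q <= C_(K+q) (1 / (K+1) + 1 / (q+1)), which is
   'C(2K, K) 'C(2q, q) <= 'C(2(K+q), K+q). *)
Require Import Defs.
From mathcomp Require Import all_boot all_order all_algebra all_fingroup.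
From mathcomp Require Import all_classical all_reals all_analysis.
From mathcomp Require Import zify ring.

Set Implicit Arguments.
Unset Strict Implicit.
Unset Printing Implicit Defensive.

Import Order.TTheory GRing.Theory Num.Theory.
Import numFieldNormedType.Exports.

(** * Avoidance of 321 and 123 in terms of three positions *)

Lemma contains_pattern3P n (tau : 'S_3) (s : 'S_n) :
  reflect (exists f : 'I_3 -> 'I_n, {homo f : x y / x < y} /\
             forall x y, (s (f x) < s (f y)) = (tau x < tau y))
          (contains_pattern tau s).
Proof.
apply: (iffP existsP) => [[f /andP[/forallP fi /forallP fs]]|[f [fi fs]]].
  exists f; split=> x y; first by move/forallP: (fi x) => /(_ y) /implyP.
  by move/forallP: (fs x) => /(_ y) /eqP.
exists (finfun f); apply/andP; split; apply/forallP => x; apply/forallP => y.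
  by rewrite !ffunE; apply/implyP/fi.
by rewrite !ffunE fs.
Qed.

Lemma avoiders321P n (s : 'S_n) :
  reflect (forall i j k : 'I_n, i < j -> j < k -> s k < s j -> s j < s i -> False)
          (s \in avoiders n pat321).
Proof.
have P321 (x y : 'I_3) : (pat321 x < pat321 y) = (y < x).
  by rewrite !permE /=; move: (ltn_ord x) (ltn_ord y); lia.
rewrite inE; apply: (iffP negP) => [ns i j k ij jk skj sji|nd].
  apply: ns; apply/contains_pattern3P.
  exists (fun x : 'I_3 => if x == 0 :> nat then i else if x == 1 :> nat then j else k).
  by split=> x y; rewrite ?P321; case: x y => [[|[|[|//]]] ?] [[|[|[|//]]] ?] //=; lia.
case/contains_pattern3P=> f [fi fs].
by apply: (nd (f (inord 0)) (f (inord 1)) (f (inord 2))); rewrite ?fi ?fs ?P321 ?inordK.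
Qed.

Lemma avoiders123P n (s : 'S_n) :
  reflect (forall i j k : 'I_n, i < j -> j < k -> s i < s j -> s j < s k -> False)
          (s \in avoiders n pat123).
Proof.
rewrite inE; apply: (iffP negP) => [ns i j k ij jk skj sji|nd].
  apply: ns; apply/contains_pattern3P.
  exists (fun x : 'I_3 => if x == 0 :> nat then i else if x == 1 :> nat then j else k).
  by split=> x y; rewrite ?perm1; case: x y => [[|[|[|//]]] ?] [[|[|[|//]]] ?] //=; lia.
case/contains_pattern3P=> f [fi fs].
by apply: (nd (f (inord 0)) (f (inord 1)) (f (inord 2))); rewrite ?fi ?fs ?perm1 ?inordK.
Qed.

(** The pattern 321 is an involution: the values of a decreasing triple of [s], taken as positions,
    give a decreasing triple of the inverse. *)
Lemma avoiders321V n (s : 'S_n) : (s^-1%g \in avoiders n pat321) = (s \in avoiders n pat321).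
Proof.
suff H (t : 'S_n) : t \in avoiders n pat321 -> t^-1%g \in avoiders n pat321.
  by apply/idP/idP => [/H|/H //]; rewrite invgK.
move=> /avoiders321P nd; apply/avoiders321P => i j k ij jk skj sji.
by apply: (nd _ _ _ skj sji); rewrite !permKV.
Qed.

(** * Inserting and deleting one letter *)

Lemma lift_perm_injr n (i j : 'I_n.+1) : injective (lift_perm i j).
Proof.
move=> s t est; apply/permP => k.
by apply: (@lift_inj _ j); rewrite -(lift_perm_lift i) est lift_perm_lift.
Qed.

Lemma lift_perm_bijl n (j : 'I_n.+1) :
  bijective (fun p : 'I_n.+1 * 'S_n => lift_perm p.1 j p.2).
Proof.
apply: inj_card_bij; last first.
  by rewrite card_prod card_ord !card_Sn factS.
move=> [i s] [i' t] /= est.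
have ii : i = i'.
  by apply: (@perm_inj _ (lift_perm i' j t)); rewrite lift_perm_id -est lift_perm_id.
by move: est; rewrite -ii => /lift_perm_injr ->.
Qed.

Lemma lift_perm_surj n (i : 'I_n.+1) (s : 'S_n.+1) :
  exists t, s = lift_perm i (s i) t.
Proof.
have [g gK fK] := lift_perm_bijl i.
(* [lift_perm_bijl] prescribes the value and leaves the position free; here the position is given,
   so it is applied to the inverse. *)
exists (g s^-1%g).2^-1%g.
have := fK s^-1%g; case: (g _) => j t /= e.
have : s = (lift_perm j i t)^-1%g by rewrite e invgK.
rewrite lift_permV => es; rewrite {1}es; congr (lift_perm _ _ _).
by rewrite es lift_perm_id.
Qed.

(** * Counting 321-avoiding permutations *)

(** A refinement of the 321-avoiders on which deleting the maximum gives a closed recursion; it is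
    counted by ballot numbers. *)
Definition tail_inc n m : {set 'S_n} :=
  [set s in avoiders n pat321 | [forall i : 'I_n, forall j : 'I_n,
     (n - m <= i) && (i < j) ==> (s i < s j)]].

Lemma tail_incP n m (s : 'S_n) :
  reflect (s \in avoiders n pat321 /\
           forall i j : 'I_n, n - m <= i -> i < j -> s i < s j)
          (s \in tail_inc n m).
Proof.
rewrite [s \in tail_inc _ _]inE; apply: (iffP andP) => [] [sav H]; split => //.
  by move=> i j ni ij; move/forallP: H => /(_ i)/forallP/(_ j); rewrite ni ij.
by apply/forallP=> i; apply/forallP => j; apply/implyP=> /andP[]; apply: H.
Qed.

Lemma lift_perm_max n (i : 'I_n.+1) (t : 'S_n) k :
  lift_perm i ord_max t (lift i k) = t k :> nat.
Proof. by rewrite lift_perm_lift lift_max. Qed.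

Lemma lift_perm_avoiders321 n (i j : 'I_n.+1) (t : 'S_n) :
  lift_perm i j t \in avoiders n.+1 pat321 -> t \in avoiders n pat321.
Proof.
move=> /avoiders321P nd; apply/avoiders321P=> a b c ab bc tcb tba.
by apply: (nd (lift i a) (lift i b) (lift i c)); rewrite ?lift_perm_lift /= /bump; lia.
Qed.

(* In a 321-avoider everything after the maximum is increasing, so a maximum in
   position [i < n] starts a tail that is increasing exactly from [i + 1] on. *)
Lemma lift_perm_max_tail_inc n m (i : 'I_n.+1) (t : 'S_n) :
  (lift_perm i ord_max t \in tail_inc n.+1 m.+1) =
  (t \in tail_inc n (if i == n :> nat then m else n - i)) &&
  ((i == n :> nat) || (i < n - m)).
Proof.
have lt_max k : lift_perm i ord_max t (lift i k) < n by rewrite lift_perm_max.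
have max_i : lift_perm i ord_max t i = n :> nat by rewrite lift_perm_id.
apply/tail_incP/andP => [[uav uinc]|[/tail_incP[tav tinc] iP]].
  split.
    apply/tail_incP; split; first exact: lift_perm_avoiders321 uav.
    move=> a b; case: ifP => [/eqP ein na ab|nin na ab].
      by rewrite -(lift_perm_max i) -(lift_perm_max i); apply: uinc; rewrite /= /bump; lia.
    (* An inversion after position [i] would form a 321 with the maximum standing at [i]. *)
    case: ltngtP => //.
      rewrite -(lift_perm_max i t a) -(lift_perm_max i t b) => tba.
      move/avoiders321P: uav => /(_ i (lift i a) (lift i b)).
      rewrite max_i => H; exfalso; apply: H; rewrite // /= /bump.
      - by have := ltn_ord i; lia.
      - by have := ltn_ord i; lia.
    by move=> /val_inj/perm_inj eab; move: ab; rewrite eab ltnn.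
  apply/orP; case: (ltnP i (n - m)) => [|le]; first by right.
  left; have := ltn_ord i; rewrite ltnS leq_eqVlt => /orP[//|lt_in].
  have := uinc i (lift i (Ordinal lt_in)) le; rewrite /= /bump leqnn => /(_ (ltnSn _)).
  have := lt_max (Ordinal lt_in).
  by rewrite max_i => h1 h2; have := ltn_trans h2 h1; rewrite ltnn.
have lei := ltn_ord i; split.
  apply/avoiders321P => a b c ab bc.
  have not_gt_max k : n < lift_perm i ord_max t k = false.
    by rewrite ltnNge -ltnS ltn_ord.
  case: (unliftP i c) => [c' ec|->]; last by rewrite max_i not_gt_max.
  case: (unliftP i b) => [b' eb|->]; last by rewrite max_i not_gt_max.
  move: ab bc; rewrite {}ec {}eb => ab bc.
  case: (unliftP i a) => [a' ea|ea]; move: ab bc; rewrite {}ea.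
    rewrite !lift_perm_max => ab bc; move/avoiders321P: tav; apply; move: ab bc; rewrite /= /bump; lia.
  (* Here the first letter of the triple is the maximum, so the other two lie in the increasing tail
     and cannot be inverted. *)
  move=> ab bc; rewrite !lift_perm_max => tcb _.
  have ni : i == n :> nat = false by apply/negP => /eqP ein; move: ab (ltn_ord b') => /=; rewrite /bump; lia.
  move: ab bc (tinc b' c'); rewrite ni /= /bump; lia.
move=> a b na ab.
case: (unliftP i b) => [b' eb|eb]; last first.
  case: (unliftP i a) => [a' ->|ea]; last by move: ab; rewrite ea eb ltnn.
  by rewrite eb max_i.
case: (unliftP i a) => [a' ea|ea]; last first.
  by move: ab na; rewrite ea eb; have := ltn_ord b'; move: iP; rewrite /= /bump; lia.
move: ab na; rewrite ea eb !lift_perm_max /= => ab na; apply: tinc; last by move: ab; rewrite /bump; lia.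
by move: ab na iP; rewrite /bump; case: ifP => /eqP; lia.
Qed.

(** Sort by the position of the maximum: the last position gives the first term, a position
    [i < n - m] gives a summand, and no other position is possible. *)
Lemma card_tail_incS n m : m <= n ->
  #|tail_inc n.+1 m.+1| = #|tail_inc n m| + \sum_(i < n - m) #|tail_inc n (n - i)|.
Proof.
move=> le_mn; rewrite -sum1_card.
rewrite (reindex _ (onW_bij _ (lift_perm_bijl ord_max))) /=.
rewrite (eq_bigl (fun p : 'I_n.+1 * 'S_n =>
  predT p.1 && (lift_perm p.1 ord_max p.2 \in tail_inc n.+1 m.+1))) //.
rewrite -(pair_big_dep predT (fun i t => lift_perm i ord_max t \in tail_inc n.+1 m.+1) (fun _ _ => 1)) /=.
rewrite big_ord_recr /= addnC; congr (_ + _).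
  rewrite -sum1_card; apply: eq_bigl => t.
  by rewrite lift_perm_max_tail_inc /= eqxx andbT.
rewrite (big_ord_widen n (fun i => #|tail_inc n (n - i)|)) ?leq_subr // [RHS]big_mkcond /=.
apply: eq_bigr => i _; under eq_bigl => t do rewrite lift_perm_max_tail_inc /= (ltn_eqF (ltn_ord i)) /=.
by case: ifP => _; [under eq_bigl => t do rewrite andbT; rewrite sum1_card|
  under eq_bigl => t do rewrite andbF; rewrite big_pred0_eq].
Qed.

Lemma tail_incS0 n : tail_inc n.+1 0 = tail_inc n.+1 1.
Proof.
apply/setP=> s; apply/tail_incP/tail_incP => [] [sav H]; split => // i j ni ij.
  by have := ltn_ord j; lia.
by have := ltn_ord i; lia.
Qed.

Lemma tail_inc0 n : tail_inc n 0 = avoiders n pat321.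
Proof.
apply/setP=> s; apply/tail_incP/idP => [[]//|sav]; split=> // i j ni ij.
by have := ltn_ord i; lia.
Qed.

Lemma hockey_stick n p : \sum_(i < p) 'C(n + i, n) = 'C(n + p, n.+1).
Proof.
elim: p => [|p IH]; first by rewrite big_ord0 addn0 bin_small.
by rewrite big_ord_recr /= IH addnS binS.
Qed.

(** This is the ballot number, in additive form to avoid truncated subtraction. The recursion on the
    maximum is summed by the hockey-stick identity. *)
Lemma card_tail_inc n m : m <= n ->
  #|tail_inc n m| + 'C(2 * n - m, n.+1) = 'C(2 * n - m, n).
Proof.
elim: n m => [|n IH] m.
  rewrite leqn0 => /eqP->; rewrite tail_inc0 muln0 bin0n bin0.
  suff -> : #|avoiders 0 pat321| = 1 by [].
  rewrite -[RHS](card_Sn 0); apply: eq_card => s; rewrite [RHS]inE.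
  by apply/avoiders321P => -[].
have posm : forall m, m <= n -> #|tail_inc n.+1 m.+1| + 'C(2 * n.+1 - m.+1, n.+2) = 'C(2 * n.+1 - m.+1, n.+1).
  move=> {}m le_mn; rewrite card_tail_incS //.
  have -> : 2 * n.+1 - m.+1 = n + (n - m).+1 by lia.
  (* The term [i = 0] vanishes, which shifts the hockey-stick sum by one. *)
  have hs2 : \sum_(i < (n - m).+1) 'C(n + i, n.+1) = 'C(n + (n - m).+1, n.+2).
    rewrite big_ord_recl bin_small ?addn0 // add0n.
    by rewrite addnS -addSn -hockey_stick; apply: eq_bigr => i _; rewrite /= /bump addSnnS.
  rewrite -hs2 -hockey_stick !big_ord_recr /= [X in X + _]addnC.
  rewrite addnACA -big_split /=.
  have -> : n + (n - m) = 2 * n - m by lia.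
  rewrite -(IH m) //; congr (_ + _); apply: eq_bigr => i _.
  have lti := ltn_ord i.
  have -> : n + i = 2 * n - (n - i) by lia.
  by rewrite -IH // leq_subr.
case: m => [|m]; last exact: posm.
(* A tail of length 0 or 1 imposes nothing, so the case [m = 0] follows from [m = 1] by Pascal's
   rule and the symmetry of the odd row. *)
move=> _; rewrite tail_incS0; have := posm 0 isT.
have -> : 2 * n.+1 - 0 = (2 * n.+1 - 1).+1 by lia.
rewrite !binS.
have -> : 'C(2 * n.+1 - 1, n) = 'C(2 * n.+1 - 1, n.+1).
  by rewrite -bin_sub; [congr ('C(_, _)); lia|lia].
lia.
Qed.

Lemma card_avoiders321 n : n.+1 * #|avoiders n pat321| = 'C(2 * n, n).
Proof.
have := card_tail_inc (leq0n n); rewrite tail_inc0 subn0 => H.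
have := mul_bin_left (2 * n) n.
have -> : 2 * n - n = n by lia.
by move: H => /(congr1 (muln n.+1)); rewrite mulnDr; lia.
Qed.

(** * Increasing blocks *)

(** The equation says that [s i - i] is constant on the block, without truncated subtraction. *)
Definition runs n l K : {set 'S_n} :=
  [set s in avoiders n pat321 | [forall i : 'I_n, forall j : 'I_n,
     (K <= i < K + l) && (K <= j < K + l) ==> (s i + j == s j + i)]].

Lemma runsP n l K (s : 'S_n) :
  reflect (s \in avoiders n pat321 /\
           forall i j : 'I_n, K <= i < K + l -> K <= j < K + l -> s i + j = s j + i)
          (s \in runs n l K).
Proof.
rewrite [s \in runs _ _ _]inE; apply: (iffP andP) => [] [sav H]; split => //.
  by move=> i j iK jK; move/forallP: H => /(_ i)/forallP/(_ j); rewrite iK jK => /eqP.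
by apply/forallP=> i; apply/forallP => j; apply/implyP=> /andP[iK jK]; apply/eqP/H.
Qed.

(* Duplicates the letter in position [k]: its twin takes the next position and
   the next value, so the two play the same role in any 321 pattern. *)
Definition twin n (k : 'I_n) (s : 'S_n) : 'S_n.+1 :=
  lift_perm (lift ord0 k) (lift ord0 (s k)) s.

Lemma twin_inj n (k : 'I_n) : injective (twin k).
Proof.
move=> s t est.
have tid u : twin k u (lift ord0 k) = lift ord0 (u k) by rewrite /twin lift_perm_id.
have skk : s k = t k by apply: (@lift_inj _ ord0); rewrite -!tid est.
by move: est; rewrite /twin skk => /lift_perm_injr.
Qed.

Lemma twin_avoiders321 n (k : 'I_n) (s : 'S_n) :
  (twin k s \in avoiders n.+1 pat321) = (s \in avoiders n pat321).
Proof.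
apply/idP/idP => [|/avoiders321P nd]; first exact: lift_perm_avoiders321.
pose h := lift ord0 k.
(* [p] is the collapsing map that sends the twin position [h] back to its original [k]. *)
pose p (x : 'I_n.+1) := if unlift h x is Some y then y else k.
have pP (x : 'I_n.+1) : (x = p x + (k < x) :> nat) *
    (twin k s x = s (p x) + ((s k < s (p x)) || (x == h)) :> nat).
  rewrite /p /twin; case: unliftP => [y ->|->].
    by rewrite lift_perm_lift eq_sym (negPf (neq_lift _ _)) /= /bump; split; lia.
  by rewrite lift_perm_id eqxx /= /bump /=; split; lia.
apply/avoiders321P => a b c.
have inj (x y : 'I_n) : s x = s y :> nat -> x = y :> nat by move=> /val_inj/perm_inj->.
rewrite (pP a).2 (pP b).2 (pP c).2 => ab bc cb ba.
have ph : p h = k by rewrite /p unlift_none.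
have hE : h = k.+1 :> nat by [].
have sp (x y : 'I_n.+1) : x < y -> p x = p y :> nat -> (x = k :> nat) /\ (y = h).
  move=> xy pxy; have := (pP x).1; have := (pP y).1 => ey ex.
  have : x = k :> nat /\ y = h :> nat by lia.
  by case=> ? ?; split => //; apply: val_inj.
(* Only [k] and [h] are identified by [p], and their letters are in increasing order, so the two
   ends of an inversion stay distinct after collapsing. *)
have lt (x y : 'I_n.+1) : x < y -> twin k s y < twin k s x -> p x < p y.
  move=> xy; rewrite (pP x).2 (pP y).2 => t.
  have := pP x; have := pP y.
  case: (ltngtP (p x) (p y)) => // [lt|e]; first by have := (pP x).1; have := (pP y).1; lia.
  have [xk yh] := sp _ _ xy e.
  move: t; rewrite (val_inj e) yh ph ltnn eqxx orbT.
  have -> : (x == h) = false by apply/eqP => xh; move: xy; rewrite xh yh ltnn.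
  by rewrite /= addn1 addn0 => H; have := ltnW H; rewrite ltnn.
have slt (x y : 'I_n.+1) : x < y -> twin k s y < twin k s x -> s (p y) < s (p x).
  move=> xy t; have := lt _ _ xy t; move: t.
  rewrite (pP x).2 (pP y).2.
  case: (ltngtP (s (p x)) (s (p y))) => // [|/inj ->]; last by rewrite ltnn.
  by case: (_ || _); case: (_ || _); lia.
rewrite -(pP b).2 -(pP c).2 in cb; rewrite -(pP a).2 -(pP b).2 in ba.
by apply: (nd (p a) (p b) (p c)); rewrite ?lt ?slt.
Qed.

(** The insertion moves each later letter of the run by one in position and by one in value, which
    keeps [s i - i]. *)
Lemma twin_runs n l (k : 'I_n) (s : 'S_n) :
  (twin k s \in runs n.+1 l.+2 k) = (s \in runs n l.+1 k).
Proof.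
pose h := lift ord0 k.
have th : twin k s h = (s k).+1 :> nat by rewrite /twin lift_perm_id.
have tl (i : 'I_n) : twin k s (lift h i) = bump (s k).+1 (s i) :> nat.
  by rewrite /twin lift_perm_lift.
apply/runsP/runsP => [] [tav H]; split; rewrite ?twin_avoiders321 // in tav *.
  suff Hk (i : 'I_n) : k <= i < k + l.+1 -> s i + k = s k + i.
    by move=> i j /Hk ik /Hk jk; lia.
  move=> iK; have [ki|ik] := ltnP k i; last first.
    by have -> : i = k by apply: val_inj => /=; lia.
  have := H h (lift h i); rewrite th tl /= /bump /= => Hh.
  have : (s k).+1 + (((1 + k) <= i) + i) = ((s k).+1 <= s i) + s i + (1 + k) by apply: Hh; lia.
  lia.
have Hk (i : 'I_n) : k <= i < k + l.+1 -> s i + k = s k + i.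
  by move=> iK; apply: H => //; lia.
suff Tk (i : 'I_n.+1) : k <= i < k + l.+2 -> twin k s i + k = s k + i.
  by move=> i j /Tk ik /Tk jk; lia.
case: (unliftP h i) => [i' ->|->]; last by rewrite th /= /bump /=; lia.
move: i' => /= i'; rewrite tl /= /bump /= => iK; have : s i' + k = s k + i' by apply: Hk; lia.
case: (eqVneq i' k) => [->|/eqP ik]; first by rewrite ltnn; lia.
have : i' <> k :> nat by move=> /val_inj.
lia.
Qed.

(** A run of length at least 2 has consecutive values in positions [K] and [K + 1], so it arises
    from [twin] by deleting the second of them. *)
Lemma card_runsS n l K : K < n -> #|runs n.+1 l.+2 K| = #|runs n l.+1 K|.
Proof.
move=> ltKn; rewrite -(card_imset _ (@twin_inj _ (Ordinal ltKn))).
apply: eq_card => s; apply/idP/imsetP => [sr|[t tr ->]]; last by rewrite twin_runs.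
pose k := Ordinal ltKn; pose h := lift ord0 k.
have [t et] := lift_perm_surj h s.
suff e : s = twin k t by exists t => //; have := twin_runs l k t; rewrite -e /= sr => <-.
rewrite et /twin; congr lift_perm.
move/runsP: sr => [_ /(_ h (widen_ord (leqnSn n) k))].
rewrite /= /bump /= => H; apply: val_inj => /=; rewrite /bump /=.
have : s h + K = s (widen_ord (leqnSn n) k) + K.+1 by rewrite H //; lia.
have -> : widen_ord (leqnSn n) k = lift h k by apply: val_inj => /=; rewrite /bump /=; lia.
rewrite [in X in _ = X + _]et lift_perm_lift /= /bump.
lia.
Qed.

Lemma card_runs n l K : K < n -> #|runs (n + l) l.+1 K| = #|avoiders n pat321|.
Proof.
(* The collapse ends at a block of length 1, where the run condition is empty. *)
move=> ltKn; elim: l => [|l IH]; last by rewrite addnS card_runsS ?IH //; lia.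
rewrite addn0; apply: eq_card => s; apply/runsP/idP => [[]//|sav]; split=> // i j iK jK.
by have -> : i = j by apply: val_inj => /=; lia.
Qed.

(** * Blocks with an inversion *)

Definition dsum_fun p q (s : 'S_p) (t : 'S_q) (i : 'I_(p + q)) : 'I_(p + q) :=
  match fintype.split i with inl j => lshift q (s j) | inr j => rshift p (t j) end.

Lemma dsum_fun_inj p q (s : 'S_p) (t : 'S_q) : injective (dsum_fun s t).
Proof.
move=> i j; rewrite /dsum_fun -{2}[i]fintype.splitK -{2}[j]fintype.splitK.
by case: (fintype.split i) => x; case: (fintype.split j) => y /eqP;
  rewrite ?eq_lshift ?eq_rshift ?eq_lrshift ?eq_rlshift // => /eqP/perm_inj->.
Qed.

Definition dsum p q (s : 'S_p) (t : 'S_q) : 'S_(p + q) := perm (@dsum_fun_inj p q s t).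

Lemma dsum_lshift p q (s : 'S_p) (t : 'S_q) i : dsum s t (lshift q i) = lshift q (s i).
Proof. by rewrite permE /dsum_fun -[lshift q i]/(unsplit (inl i)) unsplitK. Qed.

Lemma dsum_rshift p q (s : 'S_p) (t : 'S_q) i : dsum s t (rshift p i) = rshift p (t i).
Proof. by rewrite permE /dsum_fun -[rshift p i]/(unsplit (inr i)) unsplitK. Qed.

Lemma dsum_inj p q : injective (fun st : 'S_p * 'S_q => dsum st.1 st.2).
Proof.
move=> [s t] [s' t'] /= e; congr (_, _); apply/permP => i.
  by apply: (@lshift_inj _ q); rewrite -(dsum_lshift s t) e dsum_lshift.
by apply: (@rshift_inj p); rewrite -(dsum_rshift s t) e dsum_rshift.
Qed.

Lemma dsum_surj p q (u : 'S_(p + q)) :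
  (forall i, (u i < p) = (i < p)) -> exists s t, u = dsum s t.
Proof.
move=> up.
have ul i : exists j, u (lshift q i) = lshift q j.
  have lt : u (lshift q i) < p by rewrite up /=.
  by exists (Ordinal lt); apply: val_inj.
have ur i : exists j, u (rshift p i) = rshift p j.
  case: (split_ordP (u (rshift p i))) => j e; last by exists j.
  by have := up (rshift p i); rewrite e /= ltn_ord ltnNge leq_addr.
have [f fP] := fin_all_exists ul; have [g gP] := fin_all_exists ur.
have fI : injective f.
  by move=> i j e; apply: (@lshift_inj _ q); apply: (@perm_inj _ u); rewrite !fP e.
have gI : injective g.
  by move=> i j e; apply: (@rshift_inj p); apply: (@perm_inj _ u); rewrite !gP e.
exists (perm fI), (perm gI); apply/permP => i.
by case: (split_ordP i) => j ->; rewrite ?dsum_lshift ?dsum_rshift permE.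
Qed.

(** The right summand lies above the left one, so no inversion, hence no 321, uses both. *)
Lemma dsum_avoiders321 p q (s : 'S_p) (t : 'S_q) :
  (dsum s t \in avoiders (p + q) pat321) =
  (s \in avoiders p pat321) && (t \in avoiders q pat321).
Proof.
apply/idP/andP => [/avoiders321P nd|[/avoiders321P sn /avoiders321P tn]].
  split; apply/avoiders321P => i j k ij jk kj ji.
    by apply: (nd (lshift q i) (lshift q j) (lshift q k)); rewrite ?dsum_lshift.
  by apply: (nd (rshift p i) (rshift p j) (rshift p k)); rewrite ?dsum_rshift /= ltn_add2l.
apply/avoiders321P => i j k.
case: (split_ordP i) => i' ->; case: (split_ordP j) => j' ->; case: (split_ordP k) => k' ->;
  rewrite ?dsum_lshift ?dsum_rshift /= ?ltn_add2l.
- exact: sn.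
- by have := ltn_ord (s j'); lia.
- by have := ltn_ord k'; lia.
- by have := ltn_ord (s i'); lia.
- by have := ltn_ord j'; lia.
- by have := ltn_ord j'; lia.
- by have := ltn_ord k'; lia.
- exact: tn.
Qed.

(** The inverse form of [Acl]: the positions of the block are prescribed and its interval of values
    is free. *)
Definition clusters n l K : {set 'S_n} :=
  [set s in avoiders n pat321 | [exists a : 'I_n, (a + l <= n) &&
     [forall i : 'I_n, (a <= s i < a + l) == (K <= i < K + l)]]].

Lemma clustersP n l K (s : 'S_n) :
  reflect (s \in avoiders n pat321 /\ exists a : 'I_n, a + l <= n /\
           forall i : 'I_n, (a <= s i < a + l) = (K <= i < K + l))
          (s \in clusters n l K).
Proof.
rewrite [s \in clusters _ _ _]inE; apply: (iffP andP) => [] [sav].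
  move=> /existsP[a /andP[an /forallP H]]; split => //; exists a; split => // i.
  exact/eqP.
move=> [a [an H]]; split => //; apply/existsP; exists a; rewrite an.
by apply/forallP => i; apply/eqP.
Qed.

Lemma runs_sub_clusters n l K : 0 < l -> K + l <= n -> runs n l K \subset clusters n l K.
Proof.
move=> l0 Kn; apply/fintype.subsetP => s /runsP[sav H]; apply/clustersP; split => //.
have ltK : K < n by lia.
have ltKl : K + l.-1 < n by lia.
have HK (i : 'I_n) : K <= i < K + l -> s i + K = s (Ordinal ltK) + i.
  by move=> iK; apply: (H i (Ordinal ltK) iK) => /=; lia.
exists (s (Ordinal ltK)); split.
  have : s (Ordinal ltKl) + K = s (Ordinal ltK) + (K + l.-1) by apply: HK => /=; lia.
  by have := ltn_ord (s (Ordinal ltKl)); lia.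
move=> i; apply/idP/idP => [si|iK]; last by have := HK _ iK; lia.
(* The value [s i] is already taken at this position of the run, so injectivity places [i] in the
   block. *)
have lti : K + (s i - s (Ordinal ltK)) < n by lia.
have e : s (Ordinal lti) + K = s (Ordinal ltK) + (K + (s i - s (Ordinal ltK))).
  by apply: HK => /=; lia.
have ei : i = Ordinal lti by apply: (@perm_inj _ s); apply: val_inj => /=; lia.
by have := congr1 val ei => /=; lia.
Qed.

Lemma card_ord_ltn n p : p <= n -> #|[set i : 'I_n | i < p]| = p.
Proof.
move=> pn; rewrite -sum1_card; under eq_bigl => i do rewrite inE.
by rewrite -(big_ord_widen n (fun=> 1)) // sum1_card card_ord.
Qed.

Lemma cluster_not_run n l K (s : 'S_n) : s \in clusters n l K :\: runs n l K ->
  0 < l -> K + l <= n ->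
  (forall i, (s i < K) = (i < K)) /\ (forall i, (s i < K + l) = (i < K + l)).
Proof.
rewrite inE => /andP[nr /clustersP[sav [a [an sK]]]] l0 Kn.
(* Without an inversion the block would be [l] increasing letters filling [l] consecutive values,
   hence a run. *)
have [i [j [Ki ij jK sji]]] : exists i j : 'I_n, [/\ K <= i, i < j, j < K + l & s j < s i].
  case: (boolP [exists i : 'I_n, exists j : 'I_n, [&& K <= i, i < j, j < K + l & s j < s i]]).
    by case/existsP=> i /existsP[j /and4P[? ? ? ?]]; exists i, j.
  move=> /existsPn ninv; case/negP: nr; apply/runsP; split => //.
  have inc (i j : 'I_n) : K <= i -> i < j -> j < K + l -> s i < s j.
    move=> Ki ij jK; case: ltngtP => // [sji|/val_inj/perm_inj e].
      by have /existsPn/(_ j) := ninv i; rewrite Ki ij jK sji.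
    by move: ij; rewrite e ltnn.
  (* [lo] climbs from the left end of the block and [hi] descends from its right end; together they
     force [s i = a + (i - K)]. *)
  have lo d : forall i : 'I_n, i = K + d :> nat -> d < l -> a + d <= s i.
    elim: d => [|d IH] i ei dl; first by have := sK i; lia.
    have ltd : K + d < n by lia.
    have := IH (Ordinal ltd) erefl; have : s (Ordinal ltd) < s i by apply: inc => /=; lia.
    lia.
  have hi d : forall i : 'I_n, i + d.+1 = K + l :> nat -> d < l -> s i + d.+1 <= a + l.
    elim: d => [|d IH] i ei dl; first by have := sK i; lia.
    have ltd : i.+1 < n by lia.
    have : s i < s (Ordinal ltd) by apply: inc => /=; lia.
    have : s (Ordinal ltd) + d.+1 <= a + l by apply: IH => /=; lia.
    lia.
  suff val (i : 'I_n) : K <= i < K + l -> s i + K = a + i by move=> i j /val ? /val ?; lia.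
  move=> iK; have := @lo (i - K) i; have := @hi (K + l - i.+1) i.
  move=> h1 h2; have : s i + (K + l - i.+1).+1 <= a + l by apply: h1; lia.
  have : a + (i - K) <= s i by apply: h2; lia.
  lia.
have nd := avoiders321P _ sav.
(* A letter to the right and below the block would complete the inversion [i], [j] to a 321, and so
   would one to the left and above. *)
have lt m : (s m < a) = (m < K).
  have sm := sK m; have si := sK i; have sj := sK j.
  apply/idP/idP => mK; rewrite ltnNge; apply/negP => le.
    apply: (nd i j m) => //; lia.
  apply: (nd m i j) => //; lia.
(* By [lt], [s] maps the first [K] positions onto the first [a] values; compare cardinals. *)
have aK : a = K :> nat.
  rewrite -(card_ord_ltn (n := n) (p := K)); last by lia.
  rewrite -[LHS](card_ord_ltn (n := n)); last by lia.
  rewrite -(card_imset _ (@perm_inj _ s^-1%g)); apply: eq_card => m.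
  apply/imsetP/idP => [[x]|]; rewrite !inE => h.
    by move=> ->; rewrite -lt permKV.
  by exists (s m); rewrite ?permK // inE lt.
split=> m; first by rewrite -aK lt aK.
by have := sK m; have := lt m; lia.
Qed.

Lemma card_clusters K l q : 0 < l ->
  #|clusters (K + (l + q)) l K| =
  #|avoiders (K + q).+1 pat321| +
  (#|avoiders l pat321| - 1) * #|avoiders K pat321| * #|avoiders q pat321|.
Proof.
move=> l0; rewrite -(finset.cardsID (runs (K + (l + q)) l K)); congr (_ + _).
  rewrite (finset.setIidPr (runs_sub_clusters _ _)); [|by []|by lia].
  case: l l0 => // l _; have -> : K + (l.+1 + q) = (K + q).+1 + l by lia.
  by rewrite card_runs //; lia.
have av1 m : 1%g \in avoiders m pat321.
  by apply/avoiders321P => i j k; rewrite !perm1; lia.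
(* The subtracted 1 is the identity as middle summand, which is the case of an increasing block. *)
have -> : #|avoiders l pat321| - 1 = #|avoiders l pat321 :\ 1%g|.
  by rewrite (finset.cardsD1 1%g (avoiders l pat321)) av1 add1n subn1.
rewrite [_ * #|avoiders K _|]mulnC -mulnA -!finset.cardsX.
pose f (x : 'S_K * ('S_l * 'S_q)) := dsum x.1 (dsum x.2.1 x.2.2).
have finj : injective f.
  by move=> [s [t u]] [s' [t' u']] /=
    /(@dsum_inj _ _ (_, _) (_, _)) [-> /(@dsum_inj _ _ (_, _) (_, _))[-> ->]].
rewrite -(card_imset _ finj); apply: eq_card => s.
apply/idP/imsetP => [sF|[[s1 [r s2]] /=]].
  have [] := cluster_not_run sF l0 _; first by lia.
  move=> /dsum_surj[s1 [s' es]] lt2.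
  have [r [s2 es']] : exists r s2, s' = dsum r s2.
    apply: dsum_surj => i; have := lt2 (rshift K i).
    by rewrite es dsum_rshift /= !ltn_add2l.
  exists (s1, (r, s2)); last by rewrite es es'.
  move: sF; rewrite es es' finset.in_setD !finset.in_setX /= => /andP[nr /clustersP[+ _]].
  rewrite !dsum_avoiders321 => /and3P[av1' avr av2]; rewrite av1' av2 andbT finset.in_setD1 avr andbT /=.
  apply: contra nr => /eqP r1; apply/runsP; split; first by rewrite !dsum_avoiders321 av1' avr.
  suff H (i : 'I_(K + (l + q))) : K <= i < K + l -> dsum s1 (dsum r s2) i = i.
    by move=> i j /H -> /H ->; rewrite addnC.
  rewrite r1; case: (split_ordP i) => i' ->; first by have := ltn_ord i'; move => /=; lia.
  case: (split_ordP i') => i2 ->; last by move => /=; lia.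
  by rewrite dsum_rshift dsum_lshift perm1.
rewrite !finset.in_setX finset.in_setD1 /= => /and3P[av1' /andP[r1 avr] av2] ->.
rewrite finset.in_setD /f /=; set u := dsum _ _.
have uav : u \in avoiders _ pat321 by rewrite !dsum_avoiders321 av1' avr.
have blk i : u (rshift K (lshift q i)) = K + r i :> nat by rewrite /u dsum_rshift dsum_lshift.
apply/andP; split.
  apply: contra r1 => /runsP[_ H]; apply/eqP/permP => i; rewrite perm1; apply: val_inj => /=.
  have ri (x y : 'I_l) : r x + y = r y + x.
    have := H (rshift K (lshift q x)) (rshift K (lshift q y)).
    rewrite !blk /= => Hxy; have := ltn_ord x; have := ltn_ord y => ly lx.
    have : K + r x + (K + y) = K + r y + (K + x) by apply: Hxy; lia.
    by lia.
  (* Since [r x - x] is constant, [r] of the last index is [r 0 + (l - 1) < l], so [r 0 = 0] and [r]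
     is the identity. *)
  have last_l : l.-1 < l by lia.
  have := ri i (Ordinal l0); have := ri (Ordinal last_l) (Ordinal l0) => /=.
  by have := ltn_ord (r (Ordinal last_l)); lia.
apply/clustersP; split=> //.
have ltK : K < K + (l + q) by lia.
exists (Ordinal ltK); split => /=; first by lia.
move=> i; case: (split_ordP i) => i' ->.
  by rewrite /u dsum_lshift /=; have := ltn_ord i'; have := ltn_ord (s1 i'); lia.
case: (split_ordP i') => i2 ->; rewrite /u dsum_rshift ?dsum_lshift ?dsum_rshift /=; last by lia.
by have := ltn_ord i2; have := ltn_ord (r i2); lia.
Qed.

(** * Transfer to [Acl]: inversion for 321, reversal for 123 *)

Lemma AclP n l K (s : 'S_n) :
  reflect (exists a : 'I_n, a + l <= n /\
             forall i : 'I_n, (K <= s i < K + l) = (a <= i < a + l))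
          (s \in Acl n l K.+1).
Proof.
rewrite inE; apply: (iffP existsP) => [] [a].
  move=> /andP[an /eqP/setP e]; exists a; split=> // i.
  have := e (s i); rewrite inE addSn !ltnS => ->.
  apply/imsetP/idP => [[j]|ai]; last by exists i; rewrite ?inE.
  by rewrite inE => aj /perm_inj->.
move=> [an e]; exists a; rewrite an; apply/eqP/setP => v.
rewrite inE addSn !ltnS -(permKV s v) e.
apply/idP/imsetP => [ai|[j]]; first by exists (s^-1%g v); rewrite ?inE.
by rewrite inE => aj /perm_inj->.
Qed.

(** Taking inverses exchanges prescribed values with prescribed positions and preserves avoidance of
    321. *)
Lemma card_Acl_avoiders321 n l K :
  #|Acl n l K.+1 :&: avoiders n pat321| = #|clusters n l K|.
Proof.
rewrite -(card_imset _ (@invg_inj _)); apply: eq_card => s.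
apply/imsetP/clustersP => [[t] |[sav [a [an sa]]]].
  rewrite inE => /andP[/AclP[a [an ta]] tav] ->; split; first by rewrite avoiders321V.
  by exists a; split => // i; rewrite -ta permKV.
exists s^-1%g; last by rewrite invgK.
rewrite inE avoiders321V sav andbT; apply/AclP; exists a; split => // i.
by rewrite -sa permKV.
Qed.

Definition rev_perm n : 'S_n := perm (@rev_ord_inj n).

Lemma rev_permE n (s : 'S_n) i : (rev_perm n * s)%g i = s (rev_ord i).
Proof. by rewrite permM permE. Qed.

Lemma rev_permK n (s : 'S_n) : (rev_perm n * (rev_perm n * s))%g = s.
Proof. by apply/permP => i; rewrite !rev_permE rev_ordK. Qed.

Lemma rev_avoiders n (s : 'S_n) :
  ((rev_perm n * s)%g \in avoiders n pat123) = (s \in avoiders n pat321).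
Proof.
have rlt (i j : 'I_n) : i < j -> rev_ord j < rev_ord i.
  by have := ltn_ord j; rewrite /=; lia.
apply/avoiders123P/avoiders321P => nd i j k ij jk.
  move=> h1 h2; apply: (nd (rev_ord k) (rev_ord j) (rev_ord i)); rewrite ?rlt //.
    by rewrite !rev_permE !rev_ordK.
  by rewrite !rev_permE !rev_ordK.
rewrite !rev_permE => h1 h2.
by apply: (nd (rev_ord k) (rev_ord j) (rev_ord i)); rewrite ?rlt.
Qed.

Lemma rev_Acl n l K (s : 'S_n) : 0 < l -> ((rev_perm n * s)%g \in Acl n l K.+1) = (s \in Acl n l K.+1).
Proof.
move=> l0; suff H (t : 'S_n) : t \in Acl n l K.+1 -> (rev_perm n * t)%g \in Acl n l K.+1.
  by apply/idP/idP => [/H|/H //]; rewrite rev_permK.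
move=> /AclP[a [an ta]]; apply/AclP.
(* Reading backwards keeps the values of the block and moves its start from [a] to [n - l - a]. *)
have lt : n - l - a < n by have := ltn_ord a; lia.
exists (Ordinal lt); split => /=; first by lia.
by move=> i; rewrite rev_permE ta /=; have := ltn_ord i; lia.
Qed.

Lemma card_avoiders_mono n (tau : 'S_3) : tau = pat123 \/ tau = pat321 ->
  #|avoiders n tau| = #|avoiders n pat321|.
Proof.
case=> -> //; rewrite -[RHS](card_imset _ (@mulgI _ (rev_perm n))); apply: eq_card => s.
apply/idP/imsetP => [sav|[t tav ->]]; last by rewrite rev_avoiders.
by exists (rev_perm n * s)%g; rewrite ?rev_permK // -rev_avoiders rev_permK.
Qed.

Lemma card_Acl_avoiders n l K (tau : 'S_3) : tau = pat123 \/ tau = pat321 ->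
  0 < l -> #|Acl n l K.+1 :&: avoiders n tau| = #|clusters n l K|.
Proof.
move=> + l0; rewrite -card_Acl_avoiders321; case=> -> //.
rewrite -[RHS](card_imset _ (@mulgI _ (rev_perm n))); apply: eq_card => s.
apply/idP/imsetP => [|[t + ->]]; last by rewrite !finset.in_setI rev_avoiders rev_Acl.
move=> sA; exists (rev_perm n * s)%g; rewrite ?rev_permK //.
by move: sA; rewrite !finset.in_setI -rev_avoiders rev_permK rev_Acl.
Qed.

(** * Limits *)

Local Open Scope classical_set_scope.
Local Open Scope ring_scope.

Lemma catalanE (R : realType) n : catalan R n = #|avoiders n pat321|%:R.
Proof.
by rewrite /catalan -card_avoiders321 natrM mul1r mulKf ?pnatr_eq0.
Qed.

Lemma PavE (R : realType) (tau : 'S_3) l K q : tau = pat123 \/ tau = pat321 ->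
  (0 < l)%N ->
  Pav R tau (Acl (K + (l + q)) l K.+1) =
  (catalan R (K + q).+1 + catalan R K * (catalan R l - 1) * catalan R q) /
  catalan R (K + (l + q)).
Proof.
move=> tauP l0; rewrite /Pav card_Acl_avoiders // card_avoiders_mono // card_clusters //.
rewrite !catalanE natrD !natrM natrB 1?(mulrC (_ - _)) //.
rewrite card_gt0; apply/set0Pn; exists 1%g.
by apply/avoiders321P => i j k; rewrite !perm1 => ij jk; rewrite ltnNge (ltnW jk).
Qed.

(** * Recursion, product bound and ratios of Catalan numbers *)

Lemma catalan_gt0 (R : realType) n : 0 < catalan R n.
Proof. by rewrite mulr_gt0 ?divr_gt0 ?ltr0n // bin_gt0 leq_pmull. Qed.

Lemma catalanS (R : realType) n :
  catalan R n.+1 * n.+2%:R = catalan R n * (4 * n + 2)%:R.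
Proof.
have cE m : catalan R m * m.+1%:R = 'C(2 * m, m)%:R.
  by rewrite /catalan mul1r mulrAC mulVf ?mul1r ?pnatr_eq0.
suff bS : (n.+1 * 'C(2 * n.+1, n.+1) = (4 * n + 2) * 'C(2 * n, n))%N.
  apply: (@mulIf _ n.+1%:R); first by rewrite pnatr_eq0.
  by rewrite cE -natrM mulnC bS natrM -cE mulrC mulrAC.
have -> : (2 * n.+1 = (2 * n).+2)%N by lia.
have h1 := mul_bin_diag (2 * n).+1 n.
have h2 := mul_bin_left (2 * n).+1 n.
have h3 := mul_bin_diag (2 * n) n.
move: h1 h2 h3; rewrite !binS /=.
nia.
Qed.

(** The left side is the term of index [m] in Vandermonde's sum for the right side. *)
Lemma leq_bin_mul_central m n : ('C(2 * m, m) * 'C(2 * n, n) <= 'C(2 * (m + n), m + n))%N.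
Proof.
rewrite mulnDr -binomial.Vandermonde.
have lt : (m < (m + n).+1)%N by rewrite ltnS leq_addr.
by rewrite (bigD1 (Ordinal lt)) //= addKn leq_addr.
Qed.

(** Over the common denominator [(m + 1)(n + 1)] the right side carries the extra factor
    [(m + n + 2) / (m + n + 1)], which is at least 1; the rest is the inequality of central
    binomials. *)
Lemma catalan_mul_le (R : realType) m n :
  catalan R m * catalan R n <= catalan R (m + n) * (m.+1%:R^-1 + n.+1%:R^-1).
Proof.
have m0 : m.+1%:R != 0 :> R by rewrite pnatr_eq0.
have n0 : n.+1%:R != 0 :> R by rewrite pnatr_eq0.
have mn0 : (m + n).+1%:R != 0 :> R by rewrite pnatr_eq0.
have -> : catalan R m * catalan R n =
    ('C(2 * m, m) * 'C(2 * n, n))%N%:R / (m.+1%:R * n.+1%:R).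
  rewrite /catalan natrM; move: m.+1%:R n.+1%:R m0 n0 => a b a0 b0.
  by field; rewrite a0 b0.
apply: (@le_trans _ _ ('C(2 * (m + n), m + n)%:R / (m.+1%:R * n.+1%:R))).
  by rewrite ler_wpM2r ?invr_ge0 ?mulr_ge0 ?ler0n // ler_nat leq_bin_mul_central.
have -> : catalan R (m + n) * (m.+1%:R^-1 + n.+1%:R^-1) =
    'C(2 * (m + n), m + n)%:R * ((m.+1%:R + n.+1%:R) / (m + n).+1%:R) / (m.+1%:R * n.+1%:R).
  rewrite /catalan; move: m.+1%:R n.+1%:R (m + n).+1%:R m0 n0 mn0 => a b c a0 b0 c0.
  by field; rewrite a0 b0 c0.
rewrite ler_wpM2r ?invr_ge0 ?mulr_ge0 ?ler0n // ler_peMr ?ler0n //.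
by rewrite ler_pdivlMr ?ltr0n // mul1r -natrD ler_nat; lia.
Qed.

Lemma catalan_homo (R : realType) : {homo catalan R : m n / (m <= n)%N >-> m <= n}.
Proof.
apply: homo_leq => [//|x y z|n]; first exact: le_trans.
rewrite -(ler_pM2r (x := n.+2%:R)) ?ltr0n // catalanS.
by rewrite ler_wpM2l ?(ltW (catalan_gt0 _ _)) // ler_nat; lia.
Qed.

Lemma cvg_catalan_ratio (R : realType) j :
  catalan R n / catalan R (n + j) @[n --> \oo] --> (1 / 4 ^+ j : R).
Proof.
elim: j => [|j IH].
  under eq_fun => n do rewrite addn0 divff ?(gt_eqF (catalan_gt0 _ _)) //.
  by rewrite expr0 divr1; exact: cvg_cst.
have h1 : catalan R n / catalan R n.+1 @[n --> \oo] --> (4^-1 : R).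
  (* By the recursion the ratio is [(n + 2) / (4 n + 2)], here split into its limit and a vanishing
     term. *)
  have -> : (fun n => catalan R n / catalan R n.+1) =
      (fun n => 4^-1 + (3 / 4) * (n.*2.+1%:R^-1)).
    apply/funext => n.
    have := catalanS R n; have := catalan_gt0 R n; have := catalan_gt0 R n.+1.
    move: (catalan R n) (catalan R n.+1) => c c' c'0 c0 e.
    apply: (@mulIf _ c'); first by rewrite gt_eqF.
    rewrite mulfVK ?gt_eqF //.
    have n2 : 0 < (n.*2.+1)%:R :> R by rewrite ltr0n.
    apply: (@mulIf _ (4 * (n.*2.+1)%:R)); first by rewrite gt_eqF // mulr_gt0.
    have n2E : (n.*2.+1)%:R = 2 * n%:R + 1 :> R by rewrite -natr1 -muln2 natrM mulrC.
    have -> : c * (4 * n.*2.+1%:R) = 2 * (c * (4 * n + 2)%:R).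
      by rewrite n2E natrD natrM; ring.
    rewrite -e.
    have -> : n.+2%:R = ((n.*2.+1)%:R + 3) / 2 :> R.
      by rewrite n2E -[n.+2]addn2 natrD; field.
    by field; rewrite gt_eqF.
  rewrite -[X in _ --> X]addr0; apply: cvgD; first exact: cvg_cst.
  rewrite -[X in _ --> X](mulr0 (3 / 4)); apply: cvgMr.
  have h := @cvg_harmonic R.
  apply: (@squeeze_cvgr _ _ _ _ (fun=> 0) harmonic); [|exact: cvg_cst|exact: h].
  near=> n; rewrite invr_ge0 ler0n /= lef_pV2 ?posrE ?ltr0n // ler_nat; lia.
have -> : (fun n => catalan R n / catalan R (n + j.+1)) =
  (fun n => (catalan R n / catalan R (n + j)) * (catalan R (n + j) / catalan R (n + j).+1)).
  by apply/funext => n; rewrite mulrA mulfVK ?gt_eqF ?catalan_gt0 // addnS.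
have -> : 1 / 4 ^+ j.+1 = 1 / 4 ^+ j * 4^-1 :> R by rewrite !mul1r exprSr invfM.
apply: cvgM; first exact: IH.
by move: h1; rewrite -(cvg_shiftn j).
Unshelve. all: by end_near. Qed.

Lemma cvg_cluster_ratio (R : realType) l K : (2 <= l)%N ->
  (catalan R (K + q).+1 + catalan R K * (catalan R l - 1) * catalan R q) /
    catalan R (K + (l + q)) @[q --> \oo] -->
  (1 / 4 ^+ (l - 1) + catalan R K * (catalan R l - 1) / 4 ^+ (K + l) : R).
Proof.
move=> hl.
(* Numerator and denominator indices differ by [l - 1] in the first quotient and by [K + l] in the
   second. *)
have -> : (fun q => (catalan R (K + q).+1 + catalan R K * (catalan R l - 1) * catalan R q) /
    catalan R (K + (l + q))) =
  (fun q => catalan R (q + K.+1) / catalan R (q + K.+1 + (l - 1)) +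
     catalan R K * (catalan R l - 1) * (catalan R q / catalan R (q + (K + l)))).
  apply/funext => q; rewrite mulrDl -mulrA; congr (catalan R _ / catalan R _ + _ * (_ / catalan R _)); lia.
apply: cvgD.
  by have := @cvg_catalan_ratio R (l - 1); rewrite -(cvg_shiftn K.+1).
by apply: cvgMr; have := @cvg_catalan_ratio R (K + l); rewrite mul1r.
Qed.

Lemma cvgny_subn (u : nat -> nat) c :
  u n @[n --> \oo] --> \oo -> (u n - c)%N @[n --> \oo] --> \oo.
Proof.
move=> /cvgnyPge uoo; apply/cvgnyPge => A.
by near=> n; have : (A + c <= u n)%N by [near: n; exact: uoo]; lia.
Unshelve. all: by end_near. Qed.

Theorem corollary3 (R : realType) (tau : 'S_3)
    (htau : tau = pat123 \/ tau = pat321) (l : nat) (hl : (2 <= l)%N) :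
  (forall k : nat, (1 <= k)%N ->
     (Pav R tau (Acl n l k) @[n --> \oo] -->
        (1 / 4 ^+ (l - 1)
        + catalan R (k - 1) * (catalan R l - 1) / 4 ^+ (k + l - 1) : R))
     /\
     (Pav R tau (Acl n l (n + 2 - k - l)) @[n --> \oo] -->
        (1 / 4 ^+ (l - 1)
        + catalan R (k - 1) * (catalan R l - 1) / 4 ^+ (k + l - 1) : R)))
  /\
  (forall kn : nat -> nat,
     (forall n : nat, (l < n)%N -> (1 <= kn n <= n - l + 1)%N) ->
     kn n @[n --> \oo] --> \oo ->
     (n - kn n)%N @[n --> \oo] --> \oo ->
     Pav R tau (Acl n l (kn n)) @[n --> \oo] -->
        (1 / 4 ^+ (l - 1) : R)).
Proof.
have l0 : (0 < l)%N by lia.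
split=> [[//|K] _|kn knP kn_oo nkn_oo].
  rewrite subSS subn0 (_ : (K.+1 + l - 1 = K + l)%N); last by lia.
  have lim := @cvg_cluster_ratio R l K hl.
  (* Put [n = q + (K + l)], where [K = k - 1] letters lie on one side of the block and [q] on the
     other. *)
  split; rewrite -(cvg_shiftn (K + l)); (apply: cvg_trans; last exact: lim);
    apply: near_eq_cvg; near=> q => /=.
    by rewrite (_ : (q + (K + l) = K + (l + q))%N) ?PavE //; lia.
  (* In the mirrored case [K] and [q] trade places, and the exact formula is symmetric in them. *)
  rewrite (_ : (q + (K + l) + 2 - K.+1 - l = q.+1)%N); last by lia.
  rewrite (_ : (q + (K + l) = q + (l + K))%N); last by lia.
  rewrite PavE // (_ : (q + (l + K) = K + (l + q))%N); last by lia.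
  by rewrite (addnC q K); congr (_ / _); ring.
have lim : catalan R (n - (l - 1)) / catalan R n @[n --> \oo] --> (1 / 4 ^+ (l - 1) : R).
  rewrite -(cvg_shiftn (l - 1)); apply: cvg_trans; last exact: (@cvg_catalan_ratio R (l - 1)).
  by apply: near_eq_cvg; near=> n => /=; rewrite addnK.
have inv0 (u : nat -> nat) : u n @[n --> \oo] --> \oo -> (u n).+1%:R^-1 @[n --> \oo] --> (0 : R).
  by move=> uoo; exact: (cvg_comp _ _ uoo (@cvg_harmonic R)).
(* This is the factor from [catalan_mul_le] with [K = kn n - 1] and [q = n - kn n - (l - 1)], the
   two sides of the block; it bounds the contribution of blocks with an inversion. *)
pose err n : R := (catalan R l - 1) * ((kn n - 1).+1%:R^-1 + (n - kn n - (l - 1)).+1%:R^-1).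
have err0 : err n @[n --> \oo] --> (0 : R).
  rewrite [X in _ --> X](_ : _ = (catalan R l - 1) * (0 + 0)); last by rewrite addr0 mulr0.
  by apply: cvgMr; apply: cvgD; apply: inv0; apply: cvgny_subn.
have cl1 : 0 <= catalan R l - 1.
  rewrite subr_ge0 (le_trans _ (catalan_homo R (leq0n l))) //.
  by rewrite /catalan bin0 divr1 mulr1.
apply: (@squeeze_cvgr _ _ _ _ (fun n => catalan R (n - (l - 1)) / catalan R n)
  (fun n => catalan R (n - (l - 1)) / catalan R n + err n)); [|exact: lim|]; last first.
  by rewrite -[X in _ --> X]addr0; apply: cvgD.
near=> n.
have ln : (l < n)%N by near: n; exact: nbhs_infty_gt.
have /andP[k1 kl] := knP _ ln.
have nE : n = ((kn n - 1) + (l + (n - kn n - (l - 1))))%N by lia.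
have := @PavE R tau l (kn n - 1) (n - kn n - (l - 1)) htau l0.
rewrite -nE subn1 prednK // -subn1 => ->.
rewrite (_ : (kn n - 1 + (n - kn n - (l - 1))).+1 = (n - (l - 1)))%N; last by lia.
rewrite mulrDl lerDl lerD2l; apply/andP; split.
  by rewrite divr_ge0 ?mulr_ge0 ?(ltW (catalan_gt0 _ _)).
rewrite ler_pdivrMr ?catalan_gt0 // /err (mulrC (catalan R (kn n - 1))).
rewrite -!(mulrA (catalan R l - 1)) ler_wpM2l //.
apply: le_trans (catalan_mul_le R _ _) _.
(* What remains is that the Catalan number of index [K + q = n - l] is at most that of index [n]. *)
rewrite mulrC ler_wpM2l ?addr_ge0 ?invr_ge0 ?ler0n //.
by apply: catalan_homo; lia.
Unshelve. all: by end_near. Qed.
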